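(* Let $I\subseteq K[x,y,z]$ be a monomial ideal and let $T=T_d(I)$ be a balanced triangular region. Then $T$ admits a lozenge tiling if and only if $T$ has no $\bigtriangledown$-heavy monomial subregion.
   Context: For $d\ge1$, $\mathcal T_d$ is an equilateral triangle of side length $d$ (horizontal bottom side) subdivided into $\binom{d+1}{2}$ upward-pointing and $\binom d2$ downward-pointing unit triangles. Upward ones are labeled by the degree $d-1$ monomials of $K[x,y,z]$, downward ones by degree $d-2$ monomials: $x^{d-1}$ at the top, $y^{d-1}$ bottom-left, $z^{d-1}$ bottom-right, and an upward triangle sharing an edge with a downward one has label equal to the downward label times a variable. A subregion is a set of unit triangles. $T_d(I)$ is the subregion of unit triangles whose labels are not in $I$. A subregion is balanced if it has equally many upward- and downward-pointing triangles and $\bigtriangledown$-heavy if it has more downward- than upward-pointing triangles. For a subregion $T$ and a monomial $m$ of degree $<d$, the monomial subregion of $T$ associated to $m$ is the set of unit triangles of $T$ whose labels are divisible by $m$ (these lie in the upward triangle of side length $d-\deg m$ associated to $m$). A lozenge is a union of two unit triangles sharing an edge; a lozenge tiling covers every unit triangle of the region exactly once (the empty region counts as tileable). *)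

(* Defs.v *)
From mathcomp Require Import all_boot.
Set Implicit Arguments. Unset Strict Implicit. Unset Printing Implicit Defensive.

(* A monomial x^a y^b z^c of K[x,y,z] is represented by its exponent triple. *)
Definition mono := (nat * nat * nat)%type.
Definition mdeg (m : mono) : nat := m.1.1 + m.1.2 + m.2.
Definition mdiv (m n : mono) : bool :=
  [&& m.1.1 <= n.1.1, m.1.2 <= n.1.2 & m.2 <= n.2].

(* A monomial ideal I is determined (for our purposes) by the set of
   monomials it contains; this set is exactly an up-closed set of monomials
   (closed under multiplication by monomials), and every such set arises
   from a monomial ideal.  [I : pred mono] is that set of monomials. *)
Definition monomial_ideal (I : pred mono) : Prop :=
  forall m n, mdiv m n -> I m -> I n.

(* Unit triangles of T_d: (true, e) = upward triangle with label e,
   (false, e) = downward triangle with label e; exponents are < d. *)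
Definition tri (d : nat) := (bool * ('I_d * 'I_d * 'I_d))%type.

Definition label d (t : tri d) : mono :=
  (nat_of_ord t.2.1.1, nat_of_ord t.2.1.2, nat_of_ord t.2.2).

Definition valid d (t : tri d) : bool :=
  if t.1 then (mdeg (label t)).+1 == d else (mdeg (label t)).+2 == d.

Definition is_up d (t : tri d) : bool := t.1 && valid t.
Definition is_down d (t : tri d) : bool := ~~ t.1 && valid t.

Definition Td_of (d : nat) (I : pred mono) : {set tri d} :=
  [set t : tri d | valid t & ~~ I (label t)].

Definition n_up d (T : {set tri d}) : nat := #|[set t in T | is_up t]|.
Definition n_down d (T : {set tri d}) : nat := #|[set t in T | is_down t]|.

Definition balanced d (T : {set tri d}) : bool := n_up T == n_down T.
Definition down_heavy d (T : {set tri d}) : bool := n_up T < n_down T.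

Definition monomial_subregion d (T : {set tri d}) (m : mono) : {set tri d} :=
  [set t in T | mdiv m (label t)].

(* An upward triangle u and a downward triangle w share an edge iff
   label u = label w * (a variable). *)
Definition adjacent d (w u : tri d) : bool :=
  [&& is_down w, is_up u &
   let: (a, b, c) := label w in
   [|| label u == (a.+1, b, c), label u == (a, b.+1, c) | label u == (a, b, c.+1)]].

(* A lozenge is recorded as the pair (downward triangle, upward triangle) of
   the two unit triangles sharing an edge (every lozenge contains exactly one
   of each orientation).  A lozenge tiling of T is a set of lozenges, each
   contained in T, covering every unit triangle of T exactly once. *)
Definition lozenge_tiling d (T : {set tri d}) (L : {set tri d * tri d}) : Prop :=
  (forall p, p \in L -> [/\ adjacent p.1 p.2, p.1 \in T & p.2 \in T]) /\
  (forall t, t \in T -> #|[set p in L | (p.1 == t) || (p.2 == t)]| = 1).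

Definition tileable d (T : {set tri d}) : Prop :=
  exists L : {set tri d * tri d}, lozenge_tiling T L.

(* Main.v *)
(* A tiling matches the downward triangles of a monomial subregion injectively
   with upward ones, so no subregion is heavy.  Conversely, if Hall's condition
   fails, take a violating set [S] of downward triangles of minimal size; it is
   connected.  Let [m] be the gcd of its labels: [S] touches the three sides of
   the triangle of [m].  A connected set of upward triangles missed by [S]
   cannot touch all three sides as well (the game of Y has one winner), so
   dividing by a variable matches the missed upward triangles with downward ones
   outside [S].  Hence the subregion of [m] has at least the excess of [S]. *)
Require Import Defs.
From mathcomp Require Import all_boot zify.
Set Implicit Arguments. Unset Strict Implicit. Unset Printing Implicit Defensive.

(** * Connected sets of monomials and the game of Y *)

Definition covers (w u : mono) : Prop :=
  let: (a, b, c) := w in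
  [\/ u = (a.+1, b, c), u = (a, b.+1, c) | u = (a, b, c.+1)].

Definition neighbors (u v : mono) : Prop := exists2 w, covers w u & covers w v.

(** Induction along neighbors replaces paths, so that [A] can be an arbitrary predicate. *)
Definition mconnected (A : mono -> Prop) : Prop :=
  forall P : mono -> Prop,
    (forall u v, A u -> A v -> neighbors u v -> P u -> P v) ->
  forall u v, A u -> A v -> P u -> P v.

(* Exponents are indexed by [nat]; every index from [2] on stands for [z]. *)
Definition expo (i : nat) (m : mono) : nat :=
  match i with 0 => m.1.1 | 1 => m.1.2 | _ => m.2 end.

(* The sides of the triangle of multiples of [m] are given by [expo i u = expo i m]. *)
Definition spans (m : mono) (A : mono -> Prop) : Prop :=
  forall i, exists2 u, A u & expo i u = expo i m.

Definition in_layer (m : mono) (k : nat) (A : mono -> Prop) : Prop :=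
  forall u, A u -> mdiv m u /\ mdeg u = mdeg m + k.

Definition majority (A : mono -> Prop) (w : mono) : Prop :=
  exists u v, [/\ u <> v, covers w u, covers w v, A u & A v].

Lemma covers_neighbors (w1 w2 u : mono) :
  covers w1 u -> covers w2 u -> w1 = w2 \/ neighbors w1 w2.
Proof.
case: w1 w2 => [[a b] c] [[a' b'] c'] cov1 cov2.
have [->|/eqP neq] := eqVneq (a, b, c) (a', b', c'); [by left | right].
(* This is the gcd: for [w1 = u/x] and [w2 = u/y] it is [u/(xy)]. *)
exists (minn a a', minn b b', minn c c'); move: cov1 cov2 neq => /=;
  case=> -> [] [] e1 e2 e3 neq; try (by subst; case: neq);
  ((by constructor 1; congr (_, _, _); lia) ||
   (by constructor 2; congr (_, _, _); lia) ||
   (by constructor 3; congr (_, _, _); lia)).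
Qed.

Lemma mdivP m n : reflect (forall i, expo i m <= expo i n) (mdiv m n).
Proof.
apply: (iffP and3P) => [[? ? ?] [|[|i]] //|le].
by split; [apply: (le 0) | apply: (le 1) | apply: (le 2)].
Qed.

Lemma covers_mdiv w u : covers w u -> mdiv w u.
Proof. by case: w => [[a b] c] [] ->; rewrite /mdiv /= !leqnn ?leqnSn. Qed.

Lemma mdiv_trans m w u : mdiv m w -> mdiv w u -> mdiv m u.
Proof. by move=> /mdivP h /mdivP h'; apply/mdivP=> i; apply: leq_trans (h' i). Qed.

Lemma covers_same_expo w i : exists2 u, covers w u & expo i u = expo i w.
Proof.
case: w => [[a b] c]; case: i => [|i].
  by exists (a, b.+1, c); first constructor 2.
by exists (a.+1, b, c); [constructor 1 | case: i].
Qed.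

Lemma majority_layer m k A :
  in_layer m k.+1 A -> in_layer m k (majority A).
Proof.
move=> lA w [u [v [neq cu cv Au Av]]].
have [du eu] := lA _ Au; have [dv ev] := lA _ Av.
move: m w u v neq cu cv {Au Av} du eu dv ev {lA} => [[m1 m2] m3] [[a b] c] u v.
rewrite /mdiv /mdeg /= => neq [] eu [] ev; subst u v => //=; lia.
Qed.

Lemma majority_covered A w : majority A w -> exists2 u, A u & covers w u.
Proof. by case=> u [v [_ cu _ Au _]]; exists u. Qed.

(** A property of majority cells passes to the cells of [A] above them: distinct neighbors in [A]
    have a majority cell below both, and majority cells below the same cell are equal or
    neighbors. *)
Lemma majority_connected A : mconnected A -> mconnected (majority A).
Proof.
move=> cA P Pcl w1 w2 M1 M2 P1.
have [u1 A1 c1] := majority_covered M1; have [u2 A2 c2] := majority_covered M2.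
have step w w' u : majority A w -> majority A w' -> covers w u -> covers w' u ->
    P w -> P w'.
  move=> Mw Mw' cw cw' Pw; have [<- //|nb] := covers_neighbors cw cw'.
  exact: Pcl Pw.
have [] := cA (fun u => exists w, [/\ majority A w, covers w u & P w]) _ u1 u2 A1 A2.
- move=> u v Au Av [w cu cv] [w' [Mw' cw' Pw']].
  have [<-|/eqP neq] := eqVneq u v; first by exists w'.
  have Mw : majority A w by exists u, v.
  by exists w; split=> //; apply: step Pw'; eauto.
- by exists w1.
- by move=> w3 [M3 c3 P3]; apply: step P3; eauto.
Qed.

(** As soon as [A] has a second cell, connectedness gives [u] a neighbor in [A], and the cell below
    both is a majority cell. *)
Lemma majority_touch A u v : mconnected A -> A u -> A v -> u <> v ->
  exists2 w, majority A w & covers w u.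
Proof.
move=> cA Au Av neq.
have [] := cA (fun v => v = u \/ exists2 w, majority A w & covers w u) _ u v Au Av.
- move=> x y Ax Ay [w cx cy] [ex|]; last by right.
  have [|/eqP neqy] := eqVneq y u; first by left.
  by subst x; right; exists w => //; exists u, y; split=> // e; case: neqy.
- by left.
- by move=> e; case: neq.
- by [].
Qed.

(** In a layer of positive index no cell lies on all three sides, so [A] has a second cell and some
    majority cell divides [u]; being also a multiple of [m], it lies on the same side. *)
Lemma majority_spans m k A : in_layer m k.+1 A -> mconnected A -> spans m A ->
  spans m (majority A).
Proof.
move=> lA cA sA i; have [u Au eu] := sA i.
have [w Mw cw] : exists2 w, majority A w & covers w u.
  have [_ du] := lA _ Au.
  have [x Ax ex] := sA 0; have [y Ay ey] := sA 1; have [z Az ez] := sA 2.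
  have [eux|/eqP] := eqVneq u x; last exact: majority_touch.
  have [euy|/eqP] := eqVneq u y; last exact: majority_touch.
  have [euz|/eqP] := eqVneq u z; last exact: majority_touch.
  by move: du ex ey ez; rewrite -eux -euy -euz /mdeg /=; lia.
exists w => //; apply/eqP; rewrite eqn_leq -{1}eu.
have [/mdivP -> _] := majority_layer lA Mw; rewrite andbT.
by have /mdivP := covers_mdiv cw.
Qed.

(* The game of Y has at most one winner: taking majorities over the unit
   triangles shrinks the board by one while preserving winning sets, down to a
   board with a single cell. *)
Lemma spanning_sets_meet m k A B :
    in_layer m k A -> mconnected A -> spans m A ->
    in_layer m k B -> mconnected B -> spans m B ->
  ~ (forall u, A u -> ~ B u).
Proof.
elim: k A B => [|k IH] A B lA cA sA lB cB sB dis.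
  have [[u Au _] [v Bv _]] := (sA 0, sB 0).
  suff e : u = v by apply: dis Au _; rewrite e.
  case: (lA _ Au) (lB _ Bv) => [/and3P[]] + + + + [/and3P[]].
  case: m {lA lB sA sB} u v {Au Bv} => [[m1 m2] m3] [[u1 u2] u3] [[v1 v2] v3].
  by rewrite /mdeg /= => *; congr (_, _, _); lia.
apply: (IH (majority A) (majority B) (majority_layer lA) (majority_connected cA)
  (majority_spans lA cA sA) (majority_layer lB) (majority_connected cB)
  (majority_spans lB cB sB)).
(* Two of the three covers lie in [A] and two in [B], so one lies in both. *)
move=> [[a b] c] [u [v [neq cu cv Au Av]]] [u' [v' [neq' cu' cv' Bu' Bv']]].
by case: cu cv cu' cv' => [] ? [] ? [] ? [] ?; subst; 
  try (by case: neq); try (by case: neq'); try (by apply: dis Au _); apply: dis Av _.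
Qed.

(** * Hall's marriage theorem and minimal violators *)

Section Hall.
Variables (T1 T2 : finType) (r : T1 -> T2 -> bool).
Implicit Types (S D : {set T1}) (U : {set T2}).

Definition nbhd U S := [set u in U | [exists w in S, r w u]].

Lemma nbhdU U S1 S2 : nbhd U (S1 :|: S2) = nbhd U S1 :|: nbhd U S2.
Proof.
apply/setP=> u; rewrite !inE -andb_orr; congr (_ && _).
apply/existsP/orP=> [[w /andP[/setUP[] wS wu]]|[]/existsP[w /andP[wS wu]]].
- by left; apply/existsP; exists w; rewrite wS.
- by right; apply/existsP; exists w; rewrite wS.
- by exists w; rewrite inE wS.
- by exists w; rewrite inE wS orbT.
Qed.

(** Halmos-Vaughan induction on [#|D|]: given a tight nonempty proper subset [K], match [K] and
    [D :\: K] separately; otherwise all such subsets have slack, and any edge at [x] can be removed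
    with its ends. *)
Theorem Hall_marriage (y0 : T2) D U :
    (forall S, S \subset D -> #|S| <= #|nbhd U S|) ->
  exists f : T1 -> T2, {in D &, injective f} /\
    forall w, w \in D -> (f w \in U) && r w (f w).
Proof.
have [n] := ubnP #|D|; elim: n D U => // n IH D U /ltnSE leDn hall.
have [->|/set0Pn[x xD]] := eqVneq D set0.
  by exists (fun=> y0); split=> w; rewrite inE.
have [/existsP[K /and3P[KD K0 /eqP tight]]|strict] := boolP
   [exists K : {set T1}, [&& K \proper D, K != set0 & #|nbhd U K| == #|K|]].
  have [f [finj fP]] : exists f : T1 -> T2, {in K &, injective f} /\
      forall w, w \in K -> (f w \in U) && r w (f w).
    apply: IH; first exact: leq_trans (proper_card KD) leDn.
    by move=> S SK; apply: hall; apply: subset_trans SK (proper_sub KD).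
  have [g [ginj gP]] : exists g : T1 -> T2, {in D :\: K &, injective g} /\
      forall w, w \in D :\: K -> (g w \in U :\: nbhd U K) && r w (g w).
    apply: IH.
      apply: leq_trans leDn; apply: proper_card; rewrite properE subsetDl /=.
      have [y yK] := set0Pn _ K0; apply/subsetPn; exists y.
        exact: subsetP (proper_sub KD) _ yK.
      by rewrite inE yK.
    (* Hall's condition for [S :|: K], less the equality for the tight set [K], is the one needed
       for [S]. *)
    move=> S; rewrite subsetD => /andP[SD dSK].
    have := hall (S :|: K); rewrite subUset SD (proper_sub KD) => /(_ isT).
    rewrite nbhdU cardsU (disjoint_setI0 dSK) cards0 subn0 -tight.
    have -> : nbhd (U :\: nbhd U K) S = nbhd U S :\: nbhd U K.
      by apply/setP=> u; rewrite !inE; case: (u \in U); rewrite /= ?andbT ?andbF.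
    rewrite cardsU cardsD => hallSK.
    have := subset_leq_card (subsetIr (nbhd U S) (nbhd U K)); lia.
  exists (fun w => if w \in K then f w else g w); split.
    have sep w w' : w \in K -> w' \in D -> w' \notin K -> f w != g w'.
      move=> wK w'D w'K; have := gP w'; rewrite !inE w'K w'D => /(_ isT).
      case/andP=> /andP[+ _] _; apply: contraNneq => <-.
      by have /andP[-> rw] := fP _ wK; apply/existsP; exists w; rewrite wK.
    move=> w w' wD w'D; case: ifPn => wK; case: ifPn => w'K.
    - exact: finj.
    - by move/eqP; rewrite (negPf (sep _ _ _ _ _)).
    - by move/esym/eqP; rewrite (negPf (sep _ _ _ _ _)).
    - by apply: ginj; rewrite inE ?wK ?w'K.
  move=> w wD; case: ifP => [/fP //|wK].
  by have := gP w; rewrite inE wK wD inE -andbA => /(_ isT)/and3P[_ -> ->].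
have : 0 < #|nbhd U [set x]| by apply: leq_trans (hall _ _); rewrite ?cards1 ?sub1set.
case/card_gt0P=> y; rewrite inE => /andP[yU /existsP[x' /andP[/set1P -> xy]]].
have [f [finj fP]] : exists f : T1 -> T2, {in D :\ x &, injective f} /\
      forall w, w \in D :\ x -> (f w \in U :\ y) && r w (f w).
  apply: IH; first by rewrite (cardsD1 x) xD in leDn.
  move=> S SDx; have [->|S0] := eqVneq S set0; first by rewrite cards0.
  have SD : S \proper D.
    by apply: sub_proper_trans SDx _; rewrite properD1.
  (* The slack of one pays for the loss of [y]. *)
  have lt : #|S| < #|nbhd U S|.
    rewrite ltn_neqAle hall ?(proper_sub SD) // andbT eq_sym.
    by apply: contra strict => e; apply/existsP; exists S; rewrite SD S0.
  rewrite -ltnS; apply: leq_trans lt _.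
  have -> : nbhd (U :\ y) S = nbhd U S :\ y by apply/setP=> u; rewrite !inE andbA.
  by rewrite (cardsD1 y (nbhd U S)) -add1n leq_add2r leq_b1.
exists (fun w => if w == x then y else f w); split.
  move=> w w' wD w'D.
  case: eqP => [->|/eqP wx]; case: eqP => [-> //|/eqP w'x] e.
  - by have := fP w'; rewrite !inE w'x w'D -e eqxx => /(_ isT).
  - by have := fP w; rewrite !inE wx wD e eqxx => /(_ isT).
  - by apply: finj e; rewrite !inE ?wx ?w'x.
move=> w wD; case: eqP => [->|/eqP wx]; first by rewrite yU.
by have := fP w; rewrite !inE wx wD => /(_ isT)/andP[/andP[_ ->] ->].
Qed.

(* A violator of Hall's condition of minimal size cannot split into two parts
   with disjoint neighborhoods, since one of them would be a violator. *)
Lemma Hall_marriage_or_violator (y0 : T2) D U :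
    (exists f : T1 -> T2, {in D &, injective f} /\
       forall w, w \in D -> (f w \in U) && r w (f w)) \/
    (exists S, [/\ S \subset D, #|nbhd U S| < #|S| &
       {in S &, forall s t, connect
          (fun a b => [&& a \in S, b \in S & [exists u in U, r a u && r b u]]) s t}]).
Proof.
have [/forallP hall|] := boolP
    [forall S : {set T1}, (S \subset D) ==> (#|S| <= #|nbhd U S|)].
  by left; apply: Hall_marriage => // S SD; have := hall S; rewrite SD.
rewrite negb_forall => /existsP[S0]; rewrite negb_imply -ltnNge => /andP[S0D S0v].
right; have [S /minsetP[Sv Smin] SS0] :=
  @minset_exists _ (fun S => #|nbhd U S| < #|S|) S0 S0v.
exists S; split=> //; first exact: subset_trans SS0 S0D.
move=> s t sS tS; set e := fun a b => _.
have e_sym : symmetric e.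
  move=> a b; rewrite /e andbCA; congr [&& _, _ & _].
  by apply: eq_existsb => u; rewrite [r a u && _]andbC.
(* The component of [s]; by minimality of [S] it suffices that [K] violates Hall's condition. *)
set K := [set a in S | connect e s a].
suff KS : K = S by move: tS; rewrite -KS inE => /andP[].
have KsubS : K \subset S by apply/subsetP=> a; rewrite inE => /andP[].
apply: (Smin _ _ KsubS); rewrite ltnNge; apply/negP=> leK.
have leSK : #|S :\: K| <= #|nbhd U (S :\: K)|.
  rewrite leqNgt; apply/negP => /Smin/(_ (subsetDl _ _))/setP/(_ s).
  by rewrite !inE sS connect0.
(* A common neighbor would link an element of [S :\: K] to the component. *)
have dis : nbhd U K :&: nbhd U (S :\: K) = set0.
  apply/setP=> u; rewrite !inE; apply/negP=> /andP[/andP[uU /existsP[a /andP[aK ra]]]].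
  case/andP=> _ /existsP[b /andP[]]; rewrite inE => /andP[/negP bK bS] rb.
  apply: bK; move: aK; rewrite !inE bS => /andP[aS sa].
  apply: connect_trans sa (connect1 _); rewrite /e aS bS.
  by apply/existsP; exists u; rewrite uU ra.
have := Sv; have SE : S = K :|: S :\: K by rewrite -{1}(setIidPr KsubS) setID.
rewrite {1}SE nbhdU cardsU dis cards0 subn0 -(cardsID K S) (setIidPr KsubS); lia.
Qed.
End Hall.

(** * Lozenge tilings as matchings of unit triangles *)

Section Triangles.
Variable d : nat.
Implicit Types (t u w : tri d) (T : {set tri d}).

Definition ups T := [set t in T | is_up t].
Definition downs T := [set t in T | is_down t].

Lemma label_inj t u : t.1 = u.1 -> label t = label u -> t = u.
Proof.
case: t u => b [[x y] z] [b' [[x' y'] z']] /= -> [ex ey ez].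
by congr (_, (_, _, _)); apply: val_inj.
Qed.

Lemma adjacentP w u :
  reflect [/\ is_down w, is_up u & covers (label w) (label u)] (adjacent w u).
Proof.
rewrite /adjacent; case: (label w) => [[a b] c].
by apply: (iffP and3P) => [] [-> ->] => [/or3P[] /eqP ->|[] ->];
  split=> //; [constructor 1|constructor 2|constructor 3|..]; rewrite ?eqxx ?orbT.
Qed.

(** Balance turns the injection of downward triangles into a bijection onto the upward ones. *)
Lemma matching_tileable T (f : tri d -> tri d) :
    {in T, forall t, valid t} -> balanced T -> {in downs T &, injective f} ->
    (forall w, w \in downs T -> (f w \in ups T) && adjacent w (f w)) ->
  tileable T.
Proof.
move=> Tv /eqP bal finj fP.
have im : f @: downs T = ups T.
  apply/eqP; rewrite eqEcard card_in_imset // -/(n_up T) bal leqnn andbT.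
  by apply/subsetP=> _ /imsetP[w /fP/andP[fw _] ->].
exists [set (w, f w) | w in downs T]; split=> [_ /imsetP[w wD ->]|t tT] /=.
  have /andP[fU ->] := fP _ wD.
  by move: fU wD; rewrite !inE => /andP[-> _] /andP[-> _].
have dn w : w \in downs T -> ~~ w.1 by rewrite inE => /andP[_ /andP[]].
have upf w : w \in downs T -> (f w).1.
  by case/fP/andP; rewrite inE => /andP[_ /andP[]].
have [w wD wE] : exists2 w, w \in downs T &
    forall w', w' \in downs T -> ((w' == t) || (f w' == t)) = (w' == w).
  have [tu|td] := boolP t.1.
    have : t \in ups T by rewrite inE tT /is_up tu Tv.
    rewrite -im => /imsetP[w wD tE]; exists w => // w' w'D.
    have /negPf -> : w' != t by apply: contraTneq tu => <-; apply: dn.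
    by rewrite tE (inj_in_eq finj).
  exists t => [|w' w'D]; first by rewrite inE tT /is_down td Tv.
  by rewrite orbC; have /negPf -> : f w' != t by apply: contraNneq td => <-; apply: upf.
rewrite -(cards1 (w, f w)); apply: eq_card => p; rewrite !inE.
apply/andP/eqP=> [[/imsetP[w' w'D ->]] /=|-> /=].
  by rewrite wE // => /eqP ->.
by rewrite wE // eqxx; split=> //; apply: imset_f.
Qed.

(** A lozenge whose downward triangle lies in the subregion has its upward one there too, since
    divisibility by [m] passes to multiples. *)
Lemma tileable_not_heavy T m :
  tileable T -> ~~ down_heavy (monomial_subregion T m).
Proof.
case=> L [Ladj Lcov]; rewrite /down_heavy -leqNgt.
pose Lm := [set p in L | mdiv m (label p.1)].
have inj2 : {in Lm &, injective (fun p : tri d * tri d => p.2)}.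
  move=> p q; rewrite !inE => /andP[pL _] /andP[qL _] /= e.
  have [_ _ p2T] := Ladj _ pL.
  have /eqP/cards1P[x xE] := Lcov _ p2T.
  have : p \in [set x] by rewrite -xE inE pL eqxx orbT.
  have : q \in [set x] by rewrite -xE inE qL e eqxx orbT.
  by rewrite !inE => /eqP -> /eqP ->.
apply: (@leq_trans #|Lm|).
  apply: leq_trans (leq_imset_card (fun p : tri d * tri d => p.1) Lm).
  apply/subset_leq_card/subsetP=> w; rewrite !inE => /andP[/andP[wT mw] /andP[wd _]].
  have /eqP/cards1P[p pE] := Lcov _ wT.
  have : p \in [set p] by rewrite inE.
  rewrite -pE inE => /andP[pL]; have [/adjacentP[_ pu _] _ _] := Ladj _ pL.
  case/orP=> /eqP pw; last by move: pu wd; rewrite -pw => /andP[->].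
  by apply/imsetP; exists p; rewrite ?inE ?pL ?pw.
rewrite -(card_in_imset inj2); apply/subset_leq_card/subsetP=> _ /imsetP[p + ->].
rewrite !inE => /andP[pL mp]; have [/adjacentP[_ pu cp] _ pT] := Ladj _ pL.
by rewrite pu pT (mdiv_trans mp (covers_mdiv cp)).
Qed.

Lemma connect_mconnected (e : rel (tri d)) u0 : symmetric e ->
    (forall u v, e u v -> neighbors (label u) (label v)) ->
  mconnected (fun x => exists2 t, connect e u0 t & label t = x).
Proof.
move=> e_sym e_nb P Pcl _ _ [u c0u <-] [v c0v <-].
have : connect e u v by apply: connect_trans c0v; rewrite (sym_connect_sym e_sym).
case/connectP=> p; elim: p u c0u => [|x p IH] u c0u /=; first by move=> _ ->.
case/andP=> eux ep lE Pu; have c0x := connect_trans c0u (connect1 eux).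
by apply: IH ep lE _ => //; apply: Pcl (e_nb _ _ eux) Pu; [exists u | exists x].
Qed.

Definition lower_ord (i : 'I_d) : 'I_d :=
  Ordinal (leq_ltn_trans (leq_pred i) (ltn_ord i)).

(** Division by the variable of index [i], faithful when its exponent is positive since [lower_ord]
    truncates at 0. *)
Definition lower (i : nat) t : tri d :=
  let: (_, (x, y, z)) := t in
  (false, match i with
          | 0 => (lower_ord x, y, z)
          | 1 => (x, lower_ord y, z)
          | _ => (x, y, lower_ord z)
          end).

Lemma lower_adjacent i u : is_up u -> 0 < expo i (label u) ->
  adjacent (lower i u) u.
Proof.
move=> uu u0; apply/adjacentP; move: uu u0.
case: u => [[] [[x y] z]] //; rewrite /is_up /is_down /valid /= => /eqP uu u0.
move: i u0 uu => [|[|i]]; rewrite /mdeg /= => u0 uu; split=> //; try lia;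
  [constructor 1|constructor 2|constructor 3]; congr (_, _, _) => /=; lia.
Qed.

Lemma lower_inj i u v : u.1 = v.1 -> 0 < expo i (label u) ->
  0 < expo i (label v) -> lower i u = lower i v -> u = v.
Proof.
case: u v => [b [[x y] z]] [b' [[x' y'] z']] /= ->.
by move: i => [|[|i]] /= u0 v0 [] /=; [move=> e -> -> | move=> -> e -> | move=> -> -> e];
  congr (_, (_, _, _)); apply: val_inj => /=; lia.
Qed.

Lemma lower_mdiv m i u : mdiv m (label u) -> expo i m < expo i (label u) ->
  mdiv m (label (lower i u)).
Proof.
case: u => [b [[x y] z]]; rewrite /mdiv; case: i => [|[|i]] /= /and3P[? ? ?] lt;
  by apply/and3P; split=> //=; lia.
Qed.

End Triangles.

(** * From a connected violator to a heavy monomial subregion *)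

(* The gcd [m] of [S] is such that [S] spans the triangle of multiples of [m].
   By [spanning_sets_meet], each component of the upward triangles missed by [S]
   avoids a side of that triangle, so dividing by the corresponding variable
   maps these upward triangles injectively into the downward ones outside [S]. *)
Lemma connected_violator_heavy d (I : pred mono) (S : {set tri d}) :
    monomial_ideal I -> S \subset downs (Td_of d I) ->
    #|nbhd (@adjacent d) (ups (Td_of d I)) S| < #|S| ->
    {in S &, forall s t, connect (fun a b => [&& a \in S, b \in S &
       [exists u in ups (Td_of d I), adjacent a u && adjacent b u]]) s t} ->
  exists2 m, mdeg m < d & down_heavy (monomial_subregion (Td_of d I) m).
Proof.
set T := Td_of d I; set U := ups T; set N := nbhd _ U S => Iup SD Sv Sc.
have [s0 s0S] : exists s, s \in S by apply/card_gt0P; apply: leq_ltn_trans Sv.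
have Sdown s : s \in S -> is_down s.
  by move/(subsetP SD); rewrite inE => /andP[].
have min_expo i : exists2 s, s \in S &
    forall t, t \in S -> expo i (label s) <= expo i (label t).
  by case: (arg_minnP (fun s => expo i (label s)) s0S) => s sS le; exists s.
have [m mS m_min] : exists2 m, (forall s, s \in S -> mdiv m (label s)) &
    (forall i, exists2 s, s \in S & expo i (label s) = expo i m).
  have [[x xS lex] [y yS ley]] := (min_expo 0, min_expo 1).
  have [z zS lez] := min_expo 2.
  exists (expo 0 (label x), expo 1 (label y), expo 2 (label z)) => [s sS|].
    by apply/mdivP=> -[|[|i]]; [exact: lex | exact: ley | exact: lez].
  by move=> [|[|i]]; [exists x | exists y | exists z].
have deg_down (s : tri d) : is_down s -> (mdeg (label s)).+2 = d.
  by case/andP=> /negPf s1; rewrite /valid s1 => /eqP.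
have deg_up (u : tri d) : is_up u -> (mdeg (label u)).+1 = d.
  by case/andP=> u1; rewrite /valid u1 => /eqP.
have mdeg_le n n' : mdiv n n' -> mdeg n <= mdeg n'.
  by case/and3P=> *; rewrite /mdeg !leq_add.
(* Upward labels have degree [d.-1], so the multiples of [m] among them form layer
   [d.-1 - mdeg m]. *)
have deg_m : mdeg m + (d.-1 - mdeg m) = d.-1.
  have := mdeg_le _ _ (mS _ s0S); have := deg_down _ (Sdown _ s0S); lia.
have m_lt : mdeg m < d.
  have := mdeg_le _ _ (mS _ s0S); have := deg_down _ (Sdown _ s0S); lia.
have deg_covers w u : covers w u -> mdeg u = (mdeg w).+1.
  by case: w => [[a b] c]; rewrite /mdeg => -[] -> /=; lia.
(* Labels in [I] are allowed in [A], so that it reaches all three sides. *)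
pose A x := exists2 s, s \in S & covers (label s) x.
have A_layer : in_layer m (d.-1 - mdeg m) A.
  move=> x [s sS cx]; split; first exact: mdiv_trans (mS _ sS) (covers_mdiv cx).
  by rewrite deg_m (deg_covers _ _ cx); have := deg_down _ (Sdown _ sS); lia.
have A_spans : spans m A.
  move=> i; have [s sS <-] := m_min i.
  by have [x cx ex] := covers_same_expo (label s) i; exists x => //; exists s.
have A_conn : mconnected A.
  move=> P Pcl x y [s sS cx] [t tS cy] Px.
  (* Covers of one label are mutual neighbors, so [P] spreads around each [s'], then along a path in
     [S] through shared covers. *)
  have all_s s' : s' \in S -> (exists2 z, covers (label s') z & P z) ->
      forall z, covers (label s') z -> P z.
    move=> s'S [z cz Pz] z' cz'; apply: (Pcl z) => //; [by exists s'|by exists s'|].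
    by exists (label s').
  have Ps : exists2 z, covers (label s) z & P z by exists x.
  suff : exists2 z, covers (label t) z & P z by move/(all_s _ tS); apply.
  case/connectP: (Sc _ _ sS tS) => p; elim: p s sS Ps {cx} => [|r p IH] s sS Ps /=.
    by move=> _ ->.
  case/andP=> /and3P[_ rS /existsP[u /and3P[_ /adjacentP[_ _ su] /adjacentP[_ _ ru]]]].
  by apply: IH => //; exists (label u) => //; apply: all_s su.
pose D' := [set w in downs T | mdiv m (label w)].
pose U' := [set u in U | mdiv m (label u)].
pose C := U' :\: N.
pose e u v := [&& u \in C, v \in C & [exists w, adjacent w u && adjacent w v]].
have e_sym : symmetric e.
  move=> u v; rewrite /e andbCA; congr [&& _, _ & _].
  by apply: eq_existsb => w; rewrite andbC.
have C_closed u v : u \in C -> connect e u v -> v \in C.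
  move=> uC /connectP[p]; elim: p u uC => [|x p IH] u uC /=; first by move=> _ ->.
  by case/andP=> /and3P[_ xC _]; apply: IH.
have CP u : u \in C -> [/\ u \in T, is_up u, mdiv m (label u) &
    forall s, s \in S -> ~ covers (label s) (label u)].
  rewrite !inE => /and3P[uN /andP[uT uu] mu]; split=> // s sS csu.
  case/negP: uN; rewrite uT uu; apply/existsP; exists s; rewrite sS.
  by apply/adjacentP; split=> //; apply: Sdown.
pose touches i u := [exists v, connect e u v && (expo i (label v) == expo i m)].
have untouched u : u \in C -> exists i, ~~ touches i u.
  move=> uC; pose B x := exists2 t, connect e u t & label t = x.
  have [t0|] := boolP (touches 0 u); last by exists 0.
  have [t1|] := boolP (touches 1 u); last by exists 1.
  have [t2|] := boolP (touches 2 u); last by exists 2.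
  case: (spanning_sets_meet (B := B) A_layer A_conn A_spans).
  - move=> _ [t /(C_closed _ _ uC)/CP[_ tu mt _] <-].
    by split; rewrite // deg_m; have := deg_up _ tu; lia.
  - apply: connect_mconnected => // t t' /and3P[_ _ /existsP[w /andP[]]].
    by case/adjacentP=> _ _ ct /adjacentP[_ _ ct']; exists (label w).
  - suff tB i : touches i u -> exists2 x, B x & expo i x = expo i m.
      by case=> [|[|i]]; [apply: tB t0 | apply: tB t1 | apply: tB t2].
    by case/existsP=> t /andP[cut /eqP et]; exists (label t) => //; exists t.
  - move=> x [s sS cs] [t /(C_closed _ _ uC)/CP[_ _ _ tS] tE].
    by apply: (tS s) => //; rewrite tE.
(* A side missed by the whole component of [u]: if 0 and 1 are touched, [untouched] leaves only
   2. *)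
pose side u := if touches 0 u then if touches 1 u then 2 else 1 else 0.
have side_lt u : u \in C -> expo (side u) m < expo (side u) (label u).
  move=> uC; have [_ _ /mdivP mu _] := CP _ uC.
  rewrite ltn_neqAle mu andbT eq_sym.
  have : ~~ touches (side u) u.
    rewrite /side; case: ifPn => // t0; case: ifPn => // t1.
    by have [[|[|i]]] := untouched _ uC; rewrite ?t0 ?t1.
  by apply: contra => eu; apply/existsP; exists u; rewrite connect0.
have side_connect u v : connect e u v -> side u = side v.
  move=> cuv; have tE i : touches i u = touches i v.
    by apply: eq_existsb => x; rewrite (same_connect (sym_connect_sym e_sym) cuv).
  by rewrite /side !tE.
pose g u := lower (side u) u.
have gP u : u \in C -> adjacent (g u) u.
  move=> uC; have [_ uu _ _] := CP _ uC; apply: lower_adjacent uu _.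
  exact: leq_ltn_trans (side_lt _ uC).
have g_inj : {in C &, injective g}.
  move=> u v uC vC guv; have [[_ /andP[u1 _] _ _] [_ /andP[v1 _] _ _]] := (CP _ uC, CP _ vC).
  (* Both triangles are adjacent to their common image, hence lie in one component and are divided
     by the same variable. *)
  have cuv : connect e u v.
    apply: connect1; rewrite /e uC vC; apply/existsP; exists (g u).
    by rewrite gP // guv gP.
  move: guv; rewrite /g -(side_connect _ _ cuv); apply: lower_inj.
  - by rewrite u1 v1.
  - exact: leq_ltn_trans (side_lt _ uC).
  - by rewrite (side_connect _ _ cuv); apply: leq_ltn_trans (side_lt _ vC).
have g_sub : g @: C \subset D' :\: S.
  apply/subsetP=> _ /imsetP[u uC ->]; have [uT uu mu uS] := CP _ uC.
  have /adjacentP[gd _ cg] := gP _ uC.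
  rewrite !inE gd (lower_mdiv mu (side_lt _ uC)) !andbT; apply/andP; split.
  - by apply/negP => /uS.
  (* The label of [g u] divides that of [u], which is outside the up-closed [I]. *)
  - move: uT gd; rewrite !inE /is_down => /andP[_ uI] /andP[_ ->] /=.
    by rewrite (contra _ uI) // => gI; apply: Iup (covers_mdiv cg) gI.
exists m => //; rewrite /down_heavy.
have nD : n_down (monomial_subregion T m) = #|D'|.
  by apply: eq_card => w; rewrite !inE andbAC.
have nU : n_up (monomial_subregion T m) = #|U'|.
  by apply: eq_card => u; rewrite !inE andbAC.
have SD' : S \subset D'.
  by apply/subsetP=> s sS; rewrite inE (subsetP SD) ?mS.
have NU' : N \subset U'.
  apply/subsetP=> u; rewrite !inE => /andP[-> /existsP[s /andP[sS /adjacentP[_ _ cs]]]].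
  exact: mdiv_trans (mS _ sS) (covers_mdiv cs).
(* [N] is smaller than [S], and the rest of [U'] injects into the rest of [D']. *)
have := subset_leq_card g_sub; rewrite card_in_imset // nD nU.
rewrite -(cardsID N U') -(cardsID S D') (setIidPr NU') (setIidPr SD').
by rewrite -addSn => leC; apply: leq_add Sv leC.
Qed.

Theorem theorem2p2 (d : nat) (I : pred mono) :
  1 <= d -> monomial_ideal I -> balanced (Td_of d I) ->
  (tileable (Td_of d I) <->
   (forall m : mono, mdeg m < d ->
      ~~ down_heavy (monomial_subregion (Td_of d I) m))).
Proof.
move=> d_gt0 Iup bal; split=> [til m _|light]; first exact: tileable_not_heavy.
(* The default value for the matching function; it exists because [d] is positive. *)
have t0 : tri d by split; [exact: true | do !split; exact: Ordinal d_gt0].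
have [[f [finj fP]]|[S [SD Sv Sc]]] := Hall_marriage_or_violator
    (@adjacent d) t0 (downs (Td_of d I)) (ups (Td_of d I)).
  apply: matching_tileable finj fP => // t.
  by rewrite inE => /andP[].
have [m md] := connected_violator_heavy Iup SD Sv Sc.
by rewrite (negPf (light m md)).
Qed.
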